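(* Let $k\ge 1$ be real, and let $P(z)=\sum_{j=0}^{n}a_jz^j$ be a complex polynomial of degree $n$ having all its zeros $z_1,\dots,z_n$ in $|z|\le k$. Let $\gamma=(\gamma_1,\dots,\gamma_n)$ be an $n$-tuple of non-negative real numbers, not all zero, and put $\Lambda=\sum_{j=1}^{n}\gamma_j$ and $\gamma_m=\min\{\gamma_1,\dots,\gamma_n\}$. Then $$\max_{|z|=1}|P^{\gamma}(z)|\ \ge\ \frac{\Lambda}{1+k^n}\left[1+\frac{\gamma_m}{\Lambda}\left(\frac{k^n|a_n|-|a_0|}{k^n|a_n|+|a_0|}\right)\right]\max_{|z|=1}|P(z)|,$$ where $P^\gamma$ is the generalized derivative of $P$ with respect to $\gamma$. The result is best possible for the polynomial $P(z)=(z+k)^n$.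
   Context: For $P(z)=c(z-z_1)(z-z_2)\cdots(z-z_n)$ with $c\neq 0$ (zeros listed with multiplicity) and $\gamma=(\gamma_1,\dots,\gamma_n)$ an $n$-tuple of non-negative real numbers, not all zero, the generalized derivative of $P$ is the polynomial $$P^\gamma(z):=P(z)\sum_{j=1}^n\frac{\gamma_j}{z-z_j}=\sum_{j=1}^n\gamma_j P_j(z),\qquad P_j(z)=c\prod_{i\ne j}(z-z_i).$$ For $\gamma=(1,\dots,1)$ it is the ordinary derivative $P'$.
   Formalization: The claim that the result is best possible for P(z)=(z+k)^n fails as equality in general (n=2, k=2 gives 3Λ against 9Λ/5); it is replaced by: equality holds for (z+k)^n if and only if k=1 or n=1. *)

(* Defs.v *)
From HB Require Import structures.
From mathcomp Require Import all_boot all_order all_algebra.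
From mathcomp Require Import all_classical all_reals all_analysis.
From mathcomp Require Import complex.

Set Implicit Arguments.
Unset Strict Implicit.
Unset Printing Implicit Defensive.

Import Order.TTheory GRing.Theory Num.Theory.
Import numFieldNormedType.Exports.

Local Open Scope classical_set_scope.
Local Open Scope ring_scope.
Local Open Scope complex_scope.

Notation cmod := ComplexField.Normc.normc.

(* Meaningful when z lists the zeros of P with multiplicity, so that
   lead_coef P is the constant c in P = c * \prod_j ('X - z_j). *)
Definition gderiv (R : realType) (n : nat) (g : 'I_n -> R) (P : {poly R[i]})
    (z : 'I_n -> R[i]) : {poly R[i]} :=
  \sum_(j < n) (g j)%:C *:
    (lead_coef P *: \prod_(i < n | i != j) ('X - (z i)%:P)).

(* The supremum is attained: see circle_maxP. *)
Definition circle_max (R : realType) (P : {poly R[i]}) : R :=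
  sup [set cmod P.[w] | w in [set w : R[i] | cmod w = 1]].

(* For n > 0 the infimum is attained: see tuple_minP. *)
Definition tuple_min (R : realType) (n : nat) (g : 'I_n -> R) : R :=
  inf (range g).

Lemma gderivE (R : realType) (n : nat) (g : 'I_n -> R) (P : {poly R[i]})
    (z : 'I_n -> R[i]) (w : R[i]) :
  P = lead_coef P *: \prod_(j < n) ('X - (z j)%:P) ->
  (forall j, w != z j) ->
  (gderiv g P z).[w] = P.[w] * \sum_(j < n) (g j)%:C / (w - z j).
Proof.
rewrite /gderiv; move: (lead_coef P) => c -> wz.
rewrite horner_sum mulr_sumr; apply: eq_bigr => j _.
rewrite [in RHS](bigD1 j) //= !hornerZ hornerM hornerXsubC.
have wj : w - z j != 0 by rewrite subr_eq0.
by rewrite [RHS]mulrCA -[in RHS]mulrA [in RHS]mulrAC mulfV // mul1r.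
Qed.

Lemma gderiv_deriv (R : realType) (n : nat) (P : {poly R[i]})
    (z : 'I_n -> R[i]) :
  P = lead_coef P *: \prod_(j < n) ('X - (z j)%:P) ->
  gderiv (fun=> 1) P z = P^`().
Proof.
rewrite /gderiv; move: (lead_coef P) => c ->.
rewrite derivZ; under eq_bigr do rewrite scale1r.
rewrite -scaler_sumr; congr (_ *: _).
elim: n z => [|n IHn] z; first by rewrite !big_ord0 derivC.
rewrite !big_ord_recl derivM derivXsubC mul1r -IHn; congr (_ + _).
  by rewrite big_mkcond big_ord_recl /= mul1r.
rewrite mulr_sumr; apply: eq_bigr => j _.
by rewrite big_mkcond big_ord_recl /= -big_mkcond.
Qed.

Lemma circle_maxP (R : realType) (P : {poly R[i]}) :
  (exists2 w, cmod w = 1 & cmod P.[w] = circle_max P) /\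
  (forall w, cmod w = 1 -> cmod P.[w] <= circle_max P).
Proof.
pose e (t : R) : R[i] := cos t +i* sin t.
have e1 t : cmod (e t) = 1 by rewrite /= cos2Dsin2 sqrtr1.
have eP w : cmod w = 1 -> exists2 t, t \in `[- pi, pi] & w = e t.
  case: w => x y /= /(congr1 (fun u => u ^+ 2)).
  rewrite sqr_sqrtr ?addr_ge0 ?sqr_ge0 // expr1n => xy.
  have x1 : -1 <= x <= 1.
    rewrite -ler_norml -(@expr_le1 _ 2) // real_normK ?num_real //.
    by rewrite -xy lerDl sqr_ge0.
  have yE : y ^+ 2 = sin (acos x) ^+ 2.
    apply: (@addrI _ (x ^+ 2)); rewrite xy -{1}(acosK x1) ?cos2Dsin2 //.
  have /andP[a0 api] : 0 <= acos x <= pi by rewrite acos_ge0 ?acos_lepi.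
  move/eqP: yE; rewrite eqf_sqr => /orP[] /eqP ->.
    exists (acos x); last by rewrite /e acosK.
    by rewrite in_itv /= api andbT (le_trans _ a0) // oppr_le0 pi_ge0.
  exists (- acos x); last by rewrite /e cosN sinN acosK.
  by rewrite in_itv /= lerN2 api /= (le_trans _ (pi_ge0 R)) // oppr_le0.
have [cRe cIm] : continuous (fun t => complex.Re P.[e t]) /\
                 continuous (fun t => complex.Im P.[e t]).
  elim/poly_ind: P => [|p c [cr ci]].
    by split; under eq_fun do rewrite horner0 /=; move=> t; exact: cvg_cst.
  split.
  - have -> : (fun t => complex.Re (p * 'X + c%:P).[e t]) =
      (fun t => complex.Re p.[e t] * cos t - complex.Im p.[e t] * sin t
                + complex.Re c).
      apply/funext => u; rewrite hornerMXaddC.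
      by case: (p.[e u]) => a b; case: (c).
    move=> t.
    exact: (cvgD (cvgB (cvgM (cr t) (@continuous_cos R t))
                       (cvgM (ci t) (@continuous_sin R t))) (cvg_cst _)).
  - have -> : (fun t => complex.Im (p * 'X + c%:P).[e t]) =
      (fun t => complex.Re p.[e t] * sin t + complex.Im p.[e t] * cos t
                + complex.Im c).
      apply/funext => u; rewrite hornerMXaddC.
      by case: (p.[e u]) => a b; case: (c).
    move=> t.
    exact: (cvgD (cvgD (cvgM (cr t) (@continuous_sin R t))
                       (cvgM (ci t) (@continuous_cos R t))) (cvg_cst _)).
have cn : continuous (fun t => cmod P.[e t]).
  have -> : (fun t => cmod P.[e t]) = Num.sqrt \o
      (fun t => complex.Re P.[e t] ^+ 2 + complex.Im P.[e t] ^+ 2).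
    by apply/funext => t /=; case: (P.[e t]).
  move=> t; apply: continuous_comp; last exact: sqrt_continuous.
  exact: (cvgD (cvgM (cRe t) (cRe t)) (cvgM (cIm t) (cIm t))).
have [t _ tmax] : exists2 c, c \in `[- pi, pi]%R &
    forall t, t \in `[- pi, pi]%R -> cmod P.[e t] <= cmod P.[e c].
  apply: (@EVT_max R (fun t => cmod P.[e t])).
    by rewrite (le_trans _ (pi_ge0 R)) // oppr_le0 pi_ge0.
  exact: continuous_subspaceT.
have ub w : cmod w = 1 -> cmod P.[w] <= cmod P.[e t].
  by move=> /eP[u ui ->]; exact: tmax.
suff <- : cmod P.[e t] = circle_max P by split=> //; exists (e t).
apply/eqP; rewrite eq_le; apply/andP; split.
  apply: ub_le_sup; last by exists (e t).
  by exists (cmod P.[e t]) => _ [w w1 <-]; exact: ub.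
apply: ge_sup; first by exists (cmod P.[e t]), (e t).
by move=> _ [w w1 <-]; exact: ub.
Qed.

Lemma tuple_minP (R : realType) (n : nat) (g : 'I_n -> R) : (0 < n)%N ->
  (exists j, g j = tuple_min g) /\ (forall j, tuple_min g <= g j).
Proof.
case: n g => // n g _.
have [j _ jmin] := @arg_minP _ _ _ ord0 xpredT g isT.
suff <- : g j = tuple_min g by split=> [|i]; [exists j | exact: jmin].
apply/eqP; rewrite eq_le; apply/andP; split.
  apply: lb_le_inf; first by exists (g j), j.
  by move=> _ [i _ <-]; exact: jmin.
apply: ge_inf; last by exists j.
by exists (g j) => _ [i _ <-]; exact: jmin.
Qed.

(* Main.v *)
Require Import Defs.
From mathcomp Require Import all_boot all_order all_algebra.
From mathcomp Require Import all_classical all_reals all_analysis.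
From mathcomp Require Import complex.
From mathcomp Require Import ring lra.

(** Put k ^+ n * |a_n| - |a_0| over k ^+ n * |a_n| + |a_0| equal to T, and let
    M be the maximum of |P| on the circle |z| = k.  The inequality
    combines three estimates.

    On |w| = k the quotient w * P^g(w) / P(w) is the sum of the terms
    g_j * w / (w - z_j), and since |z_j| <= |w| each w / (w - z_j) has real
    part at least k / (k + |z_j|) ([Re_div_sub_ge]).  With x_j = |z_j| / k this
    bound is 1/2 + phi(x_j)/2, where phi(x) = (1 - x) / (1 + x) is subadditive
    for products on [0, 1] ([sum_cayley_ge]), and T is phi at the product of
    the x_j ([coef_ratioE]).  Hence k |P^g(w)| >= (L + gm T) |P(w)| / 2.

    A polynomial of degree at most n - 1 bounded by 1 on the unit circle is
    bounded by k ^+ (n - 1) on |w| = k ([bernstein_walsh]), which brings the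
    maximum of P^g back from |w| = k to the unit circle.

    Finally 2 k^n |P(u)| <= (k^n + 1) M for |u| = 1 ([inner_circle_le]).  It
    comes from |f(s u)| + s^n |f(u / s)| <= (s^n + 1) max|f|, valid for every f
    of degree at most n ([reflection_sum_le]), applied to f(z) = P(k z) with
    s = k: the point u / s gives P(u), and the reflected point s u gives a
    value at least k^n |P(u)|, because the zeros of P lie in |z| <= k.

    For P = (z + k)^n one has T = 0 and the maxima of |P| and |P^g| are at
    z = 1, so equality in the bound reads 1 + k = 1 + k^n. *)

Set Implicit Arguments.
Unset Strict Implicit.
Unset Printing Implicit Defensive.

Import Order.TTheory GRing.Theory Num.Theory.
Import ComplexField.Normc.

Local Open Scope ring_scope.
Local Open Scope complex_scope.

Section ComplexPolynomials.
Variable R : realType.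
Implicit Types (x y p q w z u v : R[i]) (s k : R).

(** * The modulus of a complex number *)

Lemma cmod_ge0 x : 0 <= cmod x.
Proof. by case: x => a b; exact: sqrtr_ge0. Qed.

Lemma cmod_gt0 x : x != 0 -> 0 < cmod x.
Proof.
move=> x0; rewrite lt_neqAle cmod_ge0 andbT eq_sym.
by apply: contra x0 => /eqP/eq0_normc ->.
Qed.

Lemma cmodR s : 0 <= s -> cmod s%:C = s.
Proof. by move=> s0; rewrite /= expr0n addr0 sqrtr_sqr ger0_norm. Qed.

Lemma cmodX x n : cmod (x ^+ n) = cmod x ^+ n.
Proof. by elim: n => [|n IH]; rewrite ?expr0 ?normc1 // !exprS normcM IH. Qed.

Lemma cmod_prod (I : Type) (r : seq I) (P : pred I) (F : I -> R[i]) :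
  cmod (\prod_(i <- r | P i) F i) = \prod_(i <- r | P i) cmod (F i).
Proof. exact: (big_morph _ (@normcM R) (normc1 R)). Qed.

Lemma cmod_sum (I : Type) (r : seq I) (P : pred I) (F : I -> R[i]) :
  cmod (\sum_(i <- r | P i) F i) <= \sum_(i <- r | P i) cmod (F i).
Proof.
elim/big_ind2: _ => // [|x1 x2 y1 y2 h1 h2]; first by rewrite normc0.
by rewrite (le_trans (le_normcD _ _)) // lerD.
Qed.

Lemma cmod_factored (c : R[i]) (I : Type) (r : seq I) (z : I -> R[i]) w :
  cmod (c *: \prod_(j <- r) ('X - (z j)%:P)).[w] =
  cmod c * \prod_(j <- r) cmod (w - z j).
Proof.
rewrite hornerZ normcM horner_prod cmod_prod.
by under eq_bigr do rewrite hornerXsubC.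
Qed.

Lemma cmod_sub x y : cmod (x - y) = cmod (y - x).
Proof. by rewrite -opprB normcN. Qed.

Lemma cmod_geD x y : cmod x - cmod y <= cmod (x + y).
Proof.
by rewrite lerBlDr -{1}(addrK y x) (le_trans (le_normcD _ _)) // normcN.
Qed.

Lemma Re_le_cmod x : complex.Re x <= cmod x.
Proof.
case: x => a b /=; apply: le_trans (ler_norm a) _.
by rewrite -sqrtr_sqr ler_wsqrtr // lerDl sqr_ge0.
Qed.

(** The difference of the squares of the two sides is
    (s^2 - 1) * (|q|^2 - |p|^2).  Taken over all linear factors of a
    polynomial, this compares its values at two points that are symmetric
    with respect to a circle. *)
Lemma blaschke_le p q s : 1 <= s -> cmod p <= cmod q ->
  cmod (s%:C * p - q) <= cmod (p - s%:C * q).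
Proof.
move=> s1; case: p q => [a b] [c d]; rewrite /= !mul0r !subr0 !addr0.
have sq2 (e f : R) : 0 <= e ^+ 2 + f ^+ 2 by rewrite addr_ge0 ?sqr_ge0.
rewrite !ler_sqrt // => h.
have : 0 <= (s ^+ 2 - 1) * ((c ^+ 2 + d ^+ 2) - (a ^+ 2 + b ^+ 2)).
  by rewrite mulr_ge0 ?subr_ge0 // expr_ge1 // (le_trans ler01).
lra.
Qed.

(** Writing S for Re (w z^bar), the real part is (|w|^2 - S) / |w - z|^2; after
    clearing denominators the claim is (|w| - |z|) (S + |w| |z|) >= 0, and the
    second factor is nonnegative by Cauchy-Schwarz. *)
Lemma Re_div_sub_ge w z : cmod z <= cmod w -> w != z ->
  cmod w / (cmod w + cmod z) <= complex.Re (w / (w - z)).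
Proof.
move=> zw wz.
have wz0 : w - z != 0 by rewrite subr_eq0.
have d0 : 0 < cmod (w - z) ^+ 2 by rewrite exprn_gt0 ?cmod_gt0.
have w0 : 0 < cmod w.
  rewrite lt_neqAle cmod_ge0 andbT eq_sym; apply/eqP => h.
  have z0 : cmod z = 0 by apply/eqP; rewrite eq_le cmod_ge0 -h zw.
  by move/eqP: wz; apply; rewrite (eq0_normc h) (eq0_normc z0).
have s0 : 0 < cmod w + cmod z by rewrite ltr_wpDr ?cmod_ge0.
have E : complex.Re (w / (w - z)) * cmod (w - z) ^+ 2 =
   cmod w ^+ 2 - (complex.Re w * complex.Re z + complex.Im w * complex.Im z).
  move: d0; case: w z {zw wz wz0 w0 s0} => [a b] [c d] /=.
  rewrite !sqr_sqrtr ?addr_ge0 ?sqr_ge0 // => d0.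
  by field; rewrite lt0r_neq0.
have D : cmod (w - z) ^+ 2 = cmod w ^+ 2 -
   2 * (complex.Re w * complex.Re z + complex.Im w * complex.Im z)
   + cmod z ^+ 2.
  case: w z {zw wz wz0 w0 s0 d0 E} => [a b] [c d] /=.
  by rewrite !sqr_sqrtr ?addr_ge0 ?sqr_ge0 //; ring.
have C : - (cmod w * cmod z) <=
    complex.Re w * complex.Re z + complex.Im w * complex.Im z.
  have : cmod (w + z) ^+ 2 = cmod w ^+ 2 +
   2 * (complex.Re w * complex.Re z + complex.Im w * complex.Im z)
   + cmod z ^+ 2.
    case: w z {zw wz wz0 w0 s0 d0 E D} => [a b] [c d] /=.
    by rewrite !sqr_sqrtr ?addr_ge0 ?sqr_ge0 //; ring.
  have := cmod_geD w z.
  move=> h hD.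
  have wz1 : 0 <= cmod w - cmod z by rewrite subr_ge0.
  rewrite -(@ler_pXn2r _ 2) ?nnegrE ?cmod_ge0 // in h.
  lra.
rewrite ler_pdivrMr // -(ler_pM2r d0) [leRHS]mulrAC E D.
set S := _ + _ in C *.
rewrite -subr_ge0.
have -> : (cmod w ^+ 2 - S) * (cmod w + cmod z) -
   cmod w * (cmod w ^+ 2 - 2 * S + cmod z ^+ 2) =
   (cmod w - cmod z) * (S + cmod w * cmod z) by ring.
by rewrite mulr_ge0 ?subr_ge0 // -lerBlDr sub0r.
Qed.

(** * Growth of a polynomial bounded on the unit circle *)

(** The even and odd parts E and O of p satisfy p(v) = E(v^2) + v O(v^2), so
    E(v^2) and v O(v^2) are half the sum and half the difference of p(v) and
    p(-v).  Every point of the circle is a square, so both parts are again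
    bounded by M on the circle, and they have smaller size.  This replaces
    Cauchy's integral formula by an induction on the size. *)
Lemma coef_le_circle (p : {poly R[i]}) (M : R) :
  (forall w, cmod w = 1 -> cmod p.[w] <= M) -> forall i, cmod p`_i <= M.
Proof.
have [m] := ubnP (size p); elim: m p => [//|m IHm] p.
rewrite ltnS => pm pM j.
have M0 : 0 <= M by rewrite (le_trans _ (pM 1 (normc1 R))) ?cmod_ge0.
have [p1|p1] := leqP (size p) 1.
  rewrite (size1_polyC p1) coefC; case: ifP => _; last by rewrite normc0.
  by have := pM 1 (normc1 R); rewrite {1}(size1_polyC p1) hornerC.
have EO w : p.[w] = (even_poly p).[w ^+ 2] + (odd_poly p).[w ^+ 2] * w.
  by rewrite -{1}[p]poly_even_odd hornerD hornerMX !horner_comp hornerXn.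
have pN w : cmod w = 1 -> cmod p.[- w] <= M.
  by move=> w1; apply: pM; rewrite normcN.
have sqrt_ex w : cmod w = 1 -> exists2 v, cmod v = 1 & w = v ^+ 2.
  move=> w1; exists (sqrtc w); last by rewrite sqr_sqrtc.
  apply/eqP; rewrite -(@eqrXn2 _ 2) ?ler01 ?cmod_ge0 //.
  by rewrite expr1n -cmodX sqr_sqrtc w1.
have p2 : (uphalf (size p) < m)%N.
  case: (size p) p1 pm => [|[|s]] // _ sm; apply: leq_trans sm.
  rewrite /= !ltnS uphalf_half -{3}[s]odd_double_half -addnn leq_add2l.
  exact: leq_addr.
have half v : cmod v = 1 -> forall x,
    x *+ 2 = p.[v] + p.[- v] \/ x *+ 2 = p.[v] - p.[- v] -> cmod x <= M.
  move=> v1 x hx; rewrite -(@ler_pMn2r _ 2) // -normcMn [M *+ 2]mulr2n.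
  case: hx => ->; apply: le_trans (le_normcD _ _) _;
    rewrite ?normcN; exact: (lerD (pM _ v1) (pN _ v1)).
have ev : forall i, cmod (even_poly p)`_i <= M.
  apply: IHm => [|w /sqrt_ex [v v1 ->]].
    by rewrite (leq_ltn_trans (size_even_poly _)).
  apply: (half v) => //; left.
  by rewrite !EO sqrrN mulrN addrACA subrr addr0 mulr2n.
have ov : forall i, cmod (odd_poly p)`_i <= M.
  apply: IHm => [|w /sqrt_ex [v v1 ->]].
    rewrite (leq_ltn_trans (size_odd_poly _)) // (leq_ltn_trans _ p2) //.
    by rewrite uphalf_half leq_addl.
  rewrite -[X in X <= _]mulr1 -{1}v1 -normcM.
  apply: (half v) => //; right.
  by rewrite !EO sqrrN mulrN opprD opprK addrACA subrr add0r mulr2n.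
rewrite -[j]odd_double_half; case: (odd j) => /=.
  by rewrite add1n -coef_odd_poly.
by rewrite add0n -coef_even_poly.
Qed.

(** A linear factor is beaten by the exponential (x / y)^m when y < x; this
    removes the constants lost in estimating a polynomial by its coefficients,
    once the estimate is applied to all powers of the polynomial. *)
Lemma le_of_pow_le (x y : R) (n : nat) : 0 <= x -> 0 <= y ->
  (forall m, x ^+ m <= (n * m).+1%:R * y ^+ m) -> x <= y.
Proof.
move=> x0 y0 h; rewrite leNgt; apply/negP => yx.
have xpos : 0 < x by apply: le_lt_trans yx.
case: (ltrgtP 0 y) y0 => // [ypos _|y0 _]; last first.
  by have := h 1%N; rewrite -y0 !expr1 mulr0 leNgt xpos.
pose d := x / y - 1.
have d0 : 0 < d by rewrite subr_gt0 ltr_pdivlMr // mul1r.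
have bernoulli m : 1 + m%:R * d <= (1 + d) ^+ m.
  elim: m => [|m IH]; first by rewrite mul0r addr0 expr0.
  rewrite exprS; apply: le_trans (ler_wpM2l _ IH); last first.
    by rewrite addr_ge0 // ltW.
  rewrite -natr1; have : 0 <= m%:R * d * d by rewrite !mulr_ge0 // ltW.
  by nra.
(* Bernoulli at exponent m, squared: the left side is quadratic in m. *)
have h2 m : (1 + m%:R * d) ^+ 2 <= (n * (m * 2)).+1%:R.
  apply: (@le_trans _ _ ((1 + d) ^+ (m * 2))).
    have d1 : 0 <= 1 + d by rewrite addr_ge0 // ltW.
    rewrite exprM; apply: lerXn2r; rewrite ?nnegrE ?exprn_ge0 //.
    by rewrite addr_ge0 // mulr_ge0 // ltW.
  by rewrite /d addrC subrK expr_div_n ler_pdivrMr ?exprn_gt0.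
(* From here on m d^2 > 2 n, so m^2 d^2 alone exceeds 2 n m. *)
pose m := (Num.trunc (2 * n%:R / d ^+ 2)).+1.
have : 2 * n%:R / d ^+ 2 < m%:R by rewrite Num.Theory.truncnS_gt.
rewrite ltr_pdivrMr ?exprn_gt0 // => hm.
have := h2 m; rewrite -natr1 !natrM.
have m0 : 0 < m%:R :> R by rewrite ltr0n.
have := mulr_gt0 m0 d0.
have : m%:R * (2 * n%:R) < m%:R * (m%:R * d ^+ 2) by rewrite ltr_pM2l.
by nra.
Qed.

(** At s = 1 this is the maximum modulus principle.  The coefficients of f^m
    are at most M^m, so |f(w)|^m <= (n m + 1) (s^n M)^m for every m. *)
Lemma bernstein_walsh (n : nat) (f : {poly R[i]}) (M s : R) w :
  (size f <= n.+1)%N -> (forall u, cmod u = 1 -> cmod f.[u] <= M) ->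
  1 <= s -> cmod w <= s -> cmod f.[w] <= s ^+ n * M.
Proof.
move=> fn fM s1 ws.
have s0 : 0 <= s by rewrite (le_trans ler01).
have M0 : 0 <= M by rewrite (le_trans _ (fM 1 (normc1 R))) ?cmod_ge0.
apply: (@le_of_pow_le _ _ n); rewrite ?cmod_ge0 ?mulr_ge0 ?exprn_ge0 // => m.
have fm : (size (f ^+ m) <= (n * m).+1)%N.
  apply: leq_trans (size_poly_exp_leq _ _) _.
  by rewrite ltnS leq_mul2r; apply/orP; right; case: (size f) fn.
have cM := @coef_le_circle (f ^+ m) (M ^+ m) _.
have {}cM j : cmod (f ^+ m)`_j <= M ^+ m.
  apply: cM => u u1; rewrite horner_exp cmodX.
  by apply: lerXn2r; rewrite ?nnegrE ?cmod_ge0 //; exact: fM.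
rewrite -cmodX -horner_exp (horner_coef_wide _ fm).
apply: le_trans (cmod_sum _ _ _) _.
rewrite mulr_natl -[X in _ *+ X]card_ord -sumr_const.
apply: ler_sum => j _; rewrite normcM cmodX mulrC exprMn -exprM.
apply: ler_pM; rewrite ?exprn_ge0 ?cmod_ge0 //.
apply: (@le_trans _ _ (s ^+ j)).
  by apply: lerXn2r; rewrite ?nnegrE ?cmod_ge0.
by apply: ler_weXn2l => //; rewrite -ltnS.
Qed.

(** * The values at two points symmetric in the unit circle *)

(** The points s u and u / s are symmetric in the unit circle.  Each zero r has
    |r| >= 1, so |s u - r| <= |u - s r| = s |u / s - r|.  The degree may be
    smaller than n, which only increases the power of s. *)
Lemma zero_free_reflection_le (n : nat) (f : {poly R[i]}) s u :
  (size f <= n.+1)%N -> (forall w, cmod w < 1 -> f.[w] != 0) ->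
  1 <= s -> cmod u = 1 ->
  cmod f.[s%:C * u] <= s ^+ n * cmod f.[s^-1%:C * u].
Proof.
move=> fn f0 s1 u1; have s0 : 0 < s by apply: lt_le_trans s1.
have [r fE] := closed_field_poly_normal f.
have lc0 : lead_coef f != 0.
  rewrite lead_coef_eq0; apply: contra (f0 0 _) => [/eqP ->|].
    by rewrite horner0.
  by rewrite normc0.
have rn : (size r <= n)%N.
  by move: fn; rewrite {1}fE size_scale // size_prod_XsubC.
have r1 z : z \in r -> 1 <= cmod z.
  move=> zr; rewrite leNgt; apply/negP => /f0 /negP; apply.
  by rewrite fE -/(root _ z) rootZ // root_prod_XsubC.
apply: (@le_trans _ _ (s ^+ size r * cmod f.[s^-1%:C * u])); last first.
  by rewrite ler_wpM2r ?cmod_ge0 // ler_weXn2l.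
rewrite {}fE !(@cmod_factored _ _ _ id) mulrCA ler_wpM2l ?cmod_ge0 //.
elim: r {rn} r1 => [|z r IH] r1; first by rewrite !big_nil expr0 mulr1.
rewrite !big_cons /= exprS mulrACA ler_pM ?cmod_ge0 ?prodr_ge0 //.
- by move=> *; rewrite cmod_ge0.
- apply: le_trans (@blaschke_le u z s s1 _) _.
    by rewrite u1 r1 ?mem_head.
  have -> : u - s%:C * z = s%:C * (s^-1%:C * u - z).
    by rewrite mulrBr fmorphV mulVKf // fmorph_eq0 lt0r_neq0.
  by rewrite normcM cmodR // ltW.
- by apply: IH => x xr; rewrite r1 // in_cons xr orbT.
Qed.

(** The phase with the greatest cancellation; a = - x / |x| unless x = 0. *)
Lemma opposite_phase x s : cmod x <= s ->
  exists2 a, cmod a = 1 & cmod (x + s%:C * a) = s - cmod x.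
Proof.
move=> xs; have [->|x0] := eqVneq x 0.
  exists 1; rewrite ?normc1 // normc0 subr0 add0r mulr1 cmodR //.
  by rewrite (le_trans (cmod_ge0 x)).
have c0 := cmod_gt0 x0.
exists (- x * (cmod x)^-1%:C).
  by rewrite normcM normcN cmodR ?invr_ge0 ?ltW // mulfV // lt0r_neq0.
have -> : x + s%:C * (- x * (cmod x)^-1%:C) = - (x * (s / cmod x - 1)%:C).
  by rewrite rmorphB rmorphM rmorph1 /=; ring.
rewrite normcN normcM cmodR; last by rewrite subr_ge0 ler_pdivlMr // mul1r.
by field; rewrite lt0r_neq0.
Qed.

(** For A > M and |a| = 1 the polynomial f + A a has no zero in the closed
    disc, by the maximum principle, so its values at s u and u / s compare by
    [zero_free_reflection_le].  The phase a that makes f(u / s) and A a cancel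
    as much as possible gives
    |f(s u)| - A <= s^n (A - |f(u / s)|), and A tends to M. *)
Lemma reflection_sum_le (n : nat) (f : {poly R[i]}) (M s : R) u :
  (size f <= n.+1)%N -> (forall w, cmod w = 1 -> cmod f.[w] <= M) ->
  1 <= s -> cmod u = 1 ->
  cmod f.[s%:C * u] + s ^+ n * cmod f.[s^-1%:C * u] <= (s ^+ n + 1) * M.
Proof.
move=> fn fM s1 u1; have s0 : 0 < s by apply: lt_le_trans s1.
have sn0 : 0 < s ^+ n + 1 by rewrite ltr_wpDl // exprn_ge0 // ltW.
apply/ler_addgt0Pr => e e0; pose A := M + e / (s ^+ n + 1).
have MA : M < A by rewrite ltrDl divr_gt0.
have -> : (s ^+ n + 1) * M + e = (s ^+ n + 1) * A.
  by rewrite /A; field; rewrite lt0r_neq0.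
have disc w : cmod w <= 1 -> cmod f.[w] <= M.
  by move=> w1; have := bernstein_walsh fn fM (lexx 1) w1; rewrite expr1n mul1r.
have A0 : 0 <= A.
  rewrite (le_trans _ (ltW MA)) // (le_trans (cmod_ge0 f.[0])) //.
  by rewrite disc // normc0.
have v1 : cmod (s^-1%:C * u) <= 1.
  by rewrite normcM u1 mulr1 cmodR ?invr_ge0 ?(ltW s0) // invf_le1.
have [a a1 aE] := opposite_phase (le_trans (disc _ v1) (ltW MA)).
pose h := f + (A%:C * a)%:P.
have hE w : h.[w] = f.[w] + A%:C * a by rewrite hornerD hornerC.
have hn : (size h <= n.+1)%N.
  rewrite (leq_trans (size_polyD _ _)) // geq_max fn.
  by rewrite (leq_trans (size_polyC_leq1 _)).
have h0 w : cmod w < 1 -> h.[w] != 0.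
  move=> w1; apply/eqP => hw.
  have := disc w (ltW w1); rewrite leNgt => /negP; apply.
  have := cmod_geD (A%:C * a) f.[w].
  rewrite [_ + f.[w]]addrC -hE hw normc0 normcM a1 mulr1 cmodR //.
  by rewrite subr_le0; exact: lt_le_trans.
have := zero_free_reflection_le hn h0 s1 u1; rewrite !hE aE.
have := cmod_geD f.[s%:C * u] (A%:C * a).
rewrite normcM a1 mulr1 cmodR //.
lra.
Qed.

(** * Comparing the circles of radius 1 and k *)

(** [reflection_sum_le] for f(z) = P(k z) and s = k bounds
    |P(k^2 u)| + k^n |P(u)|.  The point k^2 u is symmetric to u in the circle
    |z| = k, outside of which P has no zeros, hence |P(k^2 u)| is at least
    k^n |P(u)|. *)
Lemma inner_circle_le (n : nat) (P : {poly R[i]}) (z : 'I_n -> R[i]) k M u :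
  1 <= k -> size P = n.+1 ->
  P = lead_coef P *: \prod_(j < n) ('X - (z j)%:P) ->
  (forall j, cmod (z j) <= k) ->
  (forall v, cmod v = 1 -> cmod P.[k%:C * v] <= M) -> cmod u = 1 ->
  2 * k ^+ n * cmod P.[u] <= (k ^+ n + 1) * M.
Proof.
move=> k1 sP PE zk PM u1; have k0 : 0 < k by apply: lt_le_trans k1.
pose f := P \Po (k%:C *: 'X).
have fE w : f.[w] = P.[k%:C * w] by rewrite horner_comp hornerZ hornerX.
have fn : (size f <= n.+1)%N.
  apply: leq_trans (size_comp_poly_leq _ _) _; rewrite sP ltnS.
  have : (size (k%:C *: 'X : {poly R[i]}) <= 2)%N.
    by rewrite (leq_trans (size_scale_leq _ _)) ?size_polyX.
  by move: (size _) => [|[|[]]] // _; rewrite ?muln0 ?muln1.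
have fM v : cmod v = 1 -> cmod f.[v] <= M by rewrite fE; exact: PM.
have := reflection_sum_le fn fM k1 u1; rewrite !fE.
have -> : k%:C * (k^-1%:C * u) = u.
  by rewrite fmorphV mulVKf // fmorph_eq0 lt0r_neq0.
have : k ^+ n * cmod P.[u] <= cmod P.[k%:C * (k%:C * u)].
  rewrite PE !cmod_factored mulrCA ler_wpM2l ?cmod_ge0 //.
  rewrite -[X in _ ^+ X]card_ord -prodr_const -big_split /=.
  apply: ler_prod => j _; rewrite mulr_ge0 ?cmod_ge0 ?(ltW k0) //=.
  have -> : k * cmod (u - z j) = cmod (k%:C * z j - k%:C * u).
    by rewrite -mulrBr normcM cmodR ?(ltW k0) // cmod_sub.
  rewrite [leRHS]cmod_sub.
  by apply: blaschke_le => //; rewrite normcM u1 mulr1 cmodR // ltW.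
lra.
Qed.

(** * The logarithmic derivative on the circle of radius k *)

Lemma prod_unit_interval (I : Type) (r : seq I) (x : I -> R) :
  (forall j, 0 <= x j <= 1) -> 0 <= \prod_(j <- r) x j <= 1.
Proof.
move=> x01; elim/big_ind: _ => // [|c d /andP[c0 c1] /andP[d0 d1]].
  by rewrite ler01 lexx.
by rewrite mulr_ge0 // mulr_ile1.
Qed.

(** With phi(x) = (1 - x) / (1 + x), the sum phi(a) + phi(b) equals
    2 (1 - a b) / ((1 + a) (1 + b)), and (1 + a) (1 + b) <= 2 (1 + a b) on
    [0, 1] because (1 - a) (1 - b) >= 0; so phi(a b) <= phi(a) + phi(b). *)
Lemma sum_cayley_ge (I : Type) (r : seq I) (x : I -> R) :
  (forall j, 0 <= x j <= 1) ->
  (1 - \prod_(j <- r) x j) / (1 + \prod_(j <- r) x j) <=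
  \sum_(j <- r) (1 - x j) / (1 + x j).
Proof.
move=> x01; elim: r => [|j r IH]; first by rewrite !big_nil subrr mul0r.
rewrite !big_cons; apply: le_trans (lerD (lexx _) IH).
have := prod_unit_interval r x01.
move: (\prod_(j <- r) x j) (x j) (x01 j) => b a /andP[a0 a1] /andP[b0 b1].
have ab0 : 0 <= a * b by rewrite mulr_ge0.
have ab1 : a * b <= 1 by rewrite mulr_ile1.
have -> : (1 - a) / (1 + a) + (1 - b) / (1 + b) =
          (1 - a * b) * (2 / ((1 + a) * (1 + b))).
  by field; apply/andP; split; apply: lt0r_neq0; lra.
rewrite ler_wpM2l ?subr_ge0 //.
rewrite ler_pdivlMr; last by apply: mulr_gt0; lra.
rewrite mulrC ler_pdivrMr; last by lra.
have : 0 <= (1 - a) * (1 - b) by rewrite mulr_ge0 ?subr_ge0.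
lra.
Qed.

(** 1 / (1 + x) is the mean of 1 and (1 - x) / (1 + x), and the weights of the
    second, nonnegative, part may be lowered to m. *)
Lemma weighted_sum_ge (n : nat) (g x : 'I_n -> R) (m : R) :
  0 <= m -> (forall j, m <= g j) -> (forall j, 0 <= x j <= 1) ->
  (\sum_(j < n) g j + m * ((1 - \prod_(j < n) x j) / (1 + \prod_(j < n) x j)))
    / 2 <= \sum_(j < n) g j / (1 + x j).
Proof.
move=> m0 mg x01.
have -> : \sum_(j < n) g j / (1 + x j) =
    (\sum_(j < n) g j + \sum_(j < n) g j * ((1 - x j) / (1 + x j))) / 2.
  rewrite -big_split mulr_suml; apply: eq_bigr => j _ /=.
  by field; apply: lt0r_neq0; case/andP: (x01 j) => ? _; lra.
rewrite ler_pM2r ?invr_gt0 ?ltr0n // lerD2l.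
apply: le_trans (ler_wpM2l m0 (sum_cayley_ge _ x01)) _.
rewrite mulr_sumr; apply: ler_sum => j _; apply: ler_wpM2r => //.
by case/andP: (x01 j) => a b; rewrite divr_ge0 //; lra.
Qed.

(** Where P does not vanish, w P^g(w) / P(w) is the sum of the
    g_j w / (w - z_j), and a modulus is at least the real part. *)
Lemma gderiv_ge (n : nat) (g : 'I_n -> R) (P : {poly R[i]})
    (z : 'I_n -> R[i]) w :
  P = lead_coef P *: \prod_(j < n) ('X - (z j)%:P) ->
  (forall j, 0 <= g j) -> (forall j, cmod (z j) <= cmod w) ->
  cmod P.[w] * (\sum_(j < n) g j * (cmod w / (cmod w + cmod (z j)))) <=
  cmod w * cmod (gderiv g P z).[w].
Proof.
move=> PE g0 zw; have [->|Pw] := eqVneq P.[w] 0.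
  by rewrite normc0 mul0r mulr_ge0 ?cmod_ge0.
have wz j : w != z j.
  apply: contra Pw => /eqP ->; rewrite PE hornerZ horner_prod (bigD1 j) //=.
  by rewrite hornerXsubC subrr mul0r mulr0.
rewrite (gderivE g PE wz) normcM mulrCA ler_wpM2l ?cmod_ge0 // -normcM.
apply: le_trans (Re_le_cmod _); rewrite mulr_sumr raddf_sum /=.
apply: ler_sum => j _.
have -> : complex.Re (w * ((g j)%:C / (w - z j))) =
          g j * complex.Re (w / (w - z j)).
  by rewrite mulrCA; case: (_ / _) => a b /=; rewrite mul0r subr0.
by rewrite ler_wpM2l // Re_div_sub_ge.
Qed.

Lemma size_gderiv_leq (n : nat) (g : 'I_n.+1 -> R) (P : {poly R[i]})
    (z : 'I_n.+1 -> R[i]) : (size (gderiv g P z) <= n.+1)%N.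
Proof.
apply: (leq_trans (size_sum _ _ _)); apply/bigmax_leqP => j _.
rewrite !(leq_trans (size_scale_leq _ _)) //.
rewrite (eq_bigl (mem (predC1 j))) // -big_enum size_prod_XsubC -cardE.
by rewrite cardC1 card_ord.
Qed.

Lemma circle_max_eq (P : {poly R[i]}) (M : R) w :
  cmod w = 1 -> cmod P.[w] = M -> (forall u, cmod u = 1 -> cmod P.[u] <= M) ->
  circle_max P = M.
Proof.
move=> w1 Pw PM; have [[u u1 <-] h] := circle_maxP P.
by apply/eqP; rewrite eq_le PM // -Pw h.
Qed.

(** * The inequality for the generalized derivative *)

(** By Vieta, |P_0| / |P_n| is the product of the |z_j|. *)
Lemma coef_ratioE (n : nat) k (P : {poly R[i]}) (z : 'I_n -> R[i]) :
  0 < k -> size P = n.+1 ->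
  P = lead_coef P *: \prod_(j < n) ('X - (z j)%:P) ->
  (k ^+ n * cmod P`_n - cmod P`_0) / (k ^+ n * cmod P`_n + cmod P`_0) =
  (1 - \prod_(j < n) (cmod (z j) / k)) / (1 + \prod_(j < n) (cmod (z j) / k)).
Proof.
move=> k0 sP PE.
have c0 : 0 < cmod (lead_coef P).
  by rewrite cmod_gt0 // lead_coef_eq0 -size_poly_eq0 sP.
have -> : P`_n = lead_coef P by rewrite lead_coefE sP.
have -> : cmod P`_0 = cmod (lead_coef P) * \prod_(j < n) cmod (z j).
  rewrite -horner_coef0 {1}PE cmod_factored; congr (_ * _).
  by apply: eq_bigr => j _; rewrite sub0r normcN.
rewrite big_split /= prodr_const card_ord exprVn.
have b0 : 0 <= \prod_(j < n) cmod (z j).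
  by apply: prodr_ge0 => j _; exact: cmod_ge0.
have kn0 : 0 < k ^+ n by rewrite exprn_gt0.
move: (\prod_(j < n) _) (k ^+ n) (cmod _) b0 kn0 c0 => b K c b0 K0 c0.
have Kb : 0 < K + b by rewrite ltr_wpDr.
by field; rewrite [c * b]mulrC -mulrDl mulf_neq0 ?lt0r_neq0.
Qed.

(** The estimate on |w| = k is used at a point k v where |P| is maximal on that
    circle. *)
Lemma gderiv_circle_max_ge (n : nat) k (g : 'I_n -> R) (m : R)
    (P : {poly R[i]}) (z : 'I_n -> R[i]) :
  1 <= k -> 0 <= m -> (forall j, m <= g j) -> (0 < n)%N ->
  size P = n.+1 ->
  P = lead_coef P *: \prod_(j < n) ('X - (z j)%:P) ->
  (forall j, cmod (z j) <= k) ->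
  (\sum_(j < n) g j + m * ((k ^+ n * cmod P`_n - cmod P`_0)
                           / (k ^+ n * cmod P`_n + cmod P`_0)))
    * circle_max P <= (1 + k ^+ n) * circle_max (gderiv g P z).
Proof.
case: n g z => // n g z k1 m0 mg _ sP PE zk.
have k0 : 0 < k by apply: lt_le_trans k1.
have g0 j : 0 <= g j by apply: le_trans (mg j).
rewrite (coef_ratioE k0 sP PE).
set T := _ / _.
pose S := \sum_(j < n.+1) g j + m * T.
have [[u u1 uE] _] := circle_maxP P; rewrite -uE.
have [[v v1 vE] vM] := circle_maxP (P \Po (k%:C *: 'X)).
have fE w : (P \Po (k%:C *: 'X)).[w] = P.[k%:C * w].
  by rewrite horner_comp hornerZ hornerX.
rewrite -{}vE fE in vM.
have hM w : cmod w = 1 -> cmod P.[k%:C * w] <= cmod P.[k%:C * v].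
  by move=> /vM; rewrite fE.
have h1 := inner_circle_le k1 sP PE zk hM u1.
have kv : cmod (k%:C * v) = k by rewrite normcM v1 mulr1 cmodR // ltW.
have zkv j : cmod (z j) <= cmod (k%:C * v) by rewrite kv.
have h2 := gderiv_ge PE g0 zkv.
have x01 j : 0 <= cmod (z j) / k <= 1.
  by rewrite divr_ge0 ?cmod_ge0 ?(ltW k0) //= ler_pdivrMr // mul1r.
have h3 := weighted_sum_ge m0 mg x01.
have [_ DM] := circle_maxP (gderiv g P z).
have kv1 : cmod (k%:C * v) <= k by rewrite kv.
have h4 := bernstein_walsh (size_gderiv_leq g P z) DM k1 kv1.
have h5 : S / 2 * cmod P.[k%:C * v] <= k ^+ n.+1 * circle_max (gderiv g P z).
  rewrite exprS -[leRHS]mulrA; apply: le_trans (ler_wpM2l (ltW k0) h4).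
  rewrite kv in h2; apply: le_trans h2; rewrite mulrC ler_wpM2l ?cmod_ge0 //.
  apply: le_trans h3 _; apply: ler_sum => j _; rewrite ler_wpM2l //.
  have := cmod_ge0 (z j); move: (cmod (z j)) => c c0.
  rewrite le_eqVlt; apply/orP; left; apply/eqP; field.
  by rewrite !lt0r_neq0 // ltr_wpDr.
have S0 : 0 <= S.
  rewrite addr_ge0 ?sumr_ge0 // mulr_ge0 //.
  have := prod_unit_interval (index_enum 'I_n.+1) x01.
  by rewrite /T => /andP[a0 a1]; rewrite divr_ge0 //; lra.
have K0 : 0 < k ^+ n.+1 by rewrite exprn_gt0.
rewrite -/S -(ler_pM2l K0).
have := ler_wpM2l S0 h1.
have : 0 <= 1 + k ^+ n.+1 by rewrite addr_ge0 // ltW.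
move/ler_wpM2l => /(_ _ _ h5).
lra.
Qed.

End ComplexPolynomials.

Theorem theorem1 (R : realType) (n : nat) (k : R) (g : 'I_n -> R)
    (hk : 1 <= k) (hg : forall j, 0 <= g j) (hg0 : exists j, g j <> 0) :
  let L := \sum_(j < n) g j in
  let gm := tuple_min g in
  let bound (P : {poly R[i]}) :=
    L / (1 + k ^+ n) *
    (1 + gm / L * ((k ^+ n * cmod P`_n - cmod P`_0)
                   / (k ^+ n * cmod P`_n + cmod P`_0))) *
    circle_max P in
  (forall (P : {poly R[i]}) (z : 'I_n -> R[i]),
     size P = n.+1 ->
     P = lead_coef P *: \prod_(j < n) ('X - (z j)%:P) ->
     (forall j, cmod (z j) <= k) ->
     bound P <= circle_max (gderiv g P z))
  /\
  (let Q : {poly R[i]} := ('X + (k%:C)%:P) ^+ n in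
   circle_max (gderiv g Q (fun=> - k%:C)) = bound Q <-> (k = 1 \/ n = 1%N)).
Proof.
move=> L gm bound.
have n0 : (0 < n)%N by case: hg0 => j _; apply: leq_trans (ltn_ord j).
have k0 : 0 < k by apply: lt_le_trans hk.
have kn0 : 0 < 1 + k ^+ n by rewrite ltr_wpDr // exprn_ge0 // ltW.
have L0 : 0 < L.
  case: hg0 => j /eqP gj; rewrite /L (bigD1 j) //= ltr_wpDr ?sumr_ge0 //.
  by rewrite lt_neqAle eq_sym gj hg.
have [[j0 gmE] gmle] := tuple_minP g n0.
have boundE P : bound P = (L + gm * ((k ^+ n * cmod P`_n - cmod P`_0)
    / (k ^+ n * cmod P`_n + cmod P`_0))) * circle_max P / (1 + k ^+ n).
  rewrite /bound; move: (_ / (_ + cmod _)) => T.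
  by field; rewrite !lt0r_neq0.
split.
  move=> P z sP PE zk; rewrite boundE ler_pdivrMr // [leRHS]mulrC.
  by apply: gderiv_circle_max_ge => //; rewrite /gm -gmE.
move=> Q.
have QE : Q = 1 *: \prod_(j < n) ('X - (- k%:C)%:P).
  by rewrite scale1r prodr_const card_ord polyCN opprK.
have lQ : lead_coef Q = 1.
  by rewrite QE scale1r; apply/eqP; rewrite -monicE monic_prod_XsubC.
have sQ : size Q = n.+1.
  by rewrite QE scale1r size_prod_XsubC /index_enum -enumT size_enum_ord.
have add_le w : cmod w = 1 -> cmod (w + k%:C) <= 1 + k.
  by move=> w1; rewrite (le_trans (le_normcD _ _)) // w1 cmodR // ltW.
have add1 : cmod (1 + k%:C) = 1 + k.
  by rewrite -(rmorph1 (real_complex R)) -rmorphD cmodR // addr_ge0 // ltW.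
have k1 : 0 <= 1 + k by rewrite addr_ge0 // ltW.
have maxQ : circle_max Q = (1 + k) ^+ n.
  have hQ w : cmod Q.[w] = cmod (w + k%:C) ^+ n.
    by rewrite /Q horner_exp cmodX hornerD hornerX hornerC.
  apply: (@circle_max_eq _ _ _ 1); rewrite ?normc1 ?hQ ?add1 // => w w1.
  by rewrite hQ lerXn2r ?nnegrE ?cmod_ge0 // add_le.
have maxD : circle_max (gderiv g Q (fun=> - k%:C)) = L * (1 + k) ^+ n.-1.
  have hD w :
      cmod (gderiv g Q (fun=> - k%:C)).[w] = L * cmod (w + k%:C) ^+ n.-1.
    rewrite /gderiv lQ horner_sum.
    have -> : \sum_(i < n) ((g i)%:C *: (1 *: \prod_(j < n | j != i)
       ('X - (- k%:C)%:P))).[w] = L%:C * (w + k%:C) ^+ n.-1.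
      rewrite /L rmorph_sum mulr_suml; apply: eq_bigr => j _ /=.
      rewrite scale1r hornerZ prodr_const horner_exp polyCN opprK hornerD.
      by rewrite hornerX hornerC cardC1 card_ord.
    by rewrite normcM cmodR ?(ltW L0) // cmodX.
  apply: (@circle_max_eq _ _ _ 1); rewrite ?normc1 ?hD ?add1 // => w w1.
  by rewrite hD ler_wpM2l ?(ltW L0) // lerXn2r ?nnegrE ?cmod_ge0 // add_le.
have Qn : Q`_n = 1 by rewrite -lQ lead_coefE sQ.
have Q0 : cmod Q`_0 = k ^+ n.
  rewrite -horner_coef0 horner_exp hornerD hornerX hornerC add0r cmodX.
  by rewrite cmodR // ltW.
rewrite boundE maxD maxQ Qn Q0 normc1 mulr1 subrr mul0r mulr0 addr0.
have -> : (1 + k) ^+ n = (1 + k) * (1 + k) ^+ n.-1 by rewrite -exprS prednK.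
have K : 0 < L * (1 + k) ^+ n.-1.
  by rewrite mulr_gt0 // exprn_gt0 // ltr_wpDr // ltW.
have E : L * ((1 + k) * (1 + k) ^+ n.-1) / (1 + k ^+ n) =
         (1 + k) / (1 + k ^+ n) * (L * (1 + k) ^+ n.-1).
  by field; rewrite lt0r_neq0.
rewrite E; split=> [|[->|->]].
- rewrite -{1}[LHS]mul1r => /(mulIf (lt0r_neq0 K)) /esym /divr1_eq.
  move/addrI; rewrite -(prednK n0) exprS -{1}[k]mulr1.
  move/(mulfI (lt0r_neq0 k0)).
  move/esym/eqP; rewrite pexprn_eq1 ?(ltW k0) // => /orP[/eqP n1|/eqP ->].
    by right; rewrite -[n]prednK // n1.
  by left.
- by rewrite expr1n divff ?mul1r // lt0r_neq0.
- by rewrite !expr1 divff ?mul1r // lt0r_neq0 // ltr_wpDr // ltW.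
Qed.
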